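(* Let $\mathbb{F}_{2^m}$ be a finite field such that $2^m-1$ is a composite number, and let $p$ be the minimal prime divisor of $2^m-1$. Let $G$ be the subgroup of the multiplicative group $\mathbb{F}_{2^m}^*$ of order $\frac{2^m-1}{p}$, and write $\mathbb{F}_{2^m}^*/G=\{\overline{1},\overline{\gamma},\dots,\overline{\gamma}^{\,p-1}\}$, where $\overline{\gamma}=\gamma G$ is a generator of $\mathbb{F}_{2^m}^*/G$. Let $a_1,\dots,a_{p-2}\in\gamma G$ be distinct. Let $1\le k<n$ and let $\alpha_1,\dots,\alpha_n$ be distinct elements of $G\cup\{a_1,\dots,a_{p-2},0\}$; put $\bm\alpha=(\alpha_1,\dots,\alpha_n)$. If $\eta\in\gamma G$, then the twisted Reed-Solomon code $TRS_{k,n}[\bm\alpha,1,0,\eta]$ over $\mathbb{F}_{2^m}$ is MDS.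
   Context: For a finite field $\mathbb{F}_q$, $\eta\in\mathbb{F}_q^*$ and distinct $\alpha_1,\dots,\alpha_n\in\mathbb{F}_q$, the twisted Reed-Solomon code with twist parameters $(t,h)=(1,0)$ is $$TRS_{k,n}[\bm\alpha,1,0,\eta]=\Big\{(f(\alpha_1),\dots,f(\alpha_n)) : f=\sum_{i=0}^{k-1}f_ix^i+\eta f_0x^{k},\ f_0,\dots,f_{k-1}\in\mathbb{F}_q\Big\}\subseteq\mathbb{F}_q^n.$$ A linear code of length $n$, dimension $k$ and minimum Hamming distance $d$ is MDS if $d=n-k+1$; here ''MDS'' means an MDS code of length $n$ and dimension $k$. *)

(* Defs.v *)
From HB Require Import structures.
From mathcomp Require Import all_boot all_order all_algebra all_fingroup all_solvable.

Set Implicit Arguments.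
Unset Strict Implicit.
Unset Printing Implicit Defensive.

Import GRing.Theory.
Local Open Scope ring_scope.

Definition composite (N : nat) : bool := (1 < N)%N && ~~ prime N.

Section Codes.

Variables (F : finFieldType) (n : nat).

Definition hamming_dist (x y : 'rV[F]_n) : nat := #|[set i | x 0 i != y 0 i]|.

Definition is_min_dist (C : {set 'rV[F]_n}) (d : nat) : Prop :=
  (exists x y, [/\ x \in C, y \in C, x != y & hamming_dist x y = d]) /\
  {in C &, forall x y, x != y -> (d <= hamming_dist x y)%N}.

Definition is_linear_code (C : {set 'rV[F]_n}) (k : nat) : Prop :=
  exists V : {vspace 'rV[F]_n}, C =i V /\ \dim V = k.

Definition is_MDS (C : {set 'rV[F]_n}) (k : nat) : Prop :=
  is_linear_code C k /\ is_min_dist C (n - k + 1).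

(* For k = 0 the tuple f is empty and f`_0 is the default value 0. *)
Definition twisted_poly (k : nat) (eta : F) (f : k.-tuple F) : {poly F} :=
  \sum_(i < k) f`_i *: 'X^i + (eta * f`_0) *: 'X^k.

(* The twisted Reed-Solomon code with twist parameters (t, h) = (1, 0). *)
Definition TRS (k : nat) (alpha : n.-tuple F) (eta : F) : {set 'rV[F]_n} :=
  [set \row_(i < n) (twisted_poly eta f).[tnth alpha i] | f : k.-tuple F].

End Codes.

(* Main.v *)
(** If a nonzero twisted polynomial [f] vanishes at [k] of the evaluation
    points, then [f_0 != 0] (otherwise its degree is below [k]), so [f] is
    [eta * f_0] times the product of the [X - alpha_i] over these points.
    Evaluating at [0] in characteristic 2 gives [eta * \prod alpha_i = 1].  But
    [eta] is in [gamma G] and at most [p - 2] of the [alpha_i] lie outside [G],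
    all of them in [gamma G]; hence the left-hand side lies in [gamma ^ j G]
    with [0 < j < p], which is not the trivial coset since [F^* / G] has
    order [p]. *)
Require Import Defs.
From HB Require Import structures.
From mathcomp Require Import all_boot all_order all_algebra all_fingroup all_solvable.
From mathcomp Require Import all_field.

Set Implicit Arguments.
Unset Strict Implicit.
Unset Printing Implicit Defensive.

Import GRing.Theory.
Local Open Scope ring_scope.

Definition num_zeros (F : finFieldType) n (x : 'rV[F]_n) : nat :=
  #|[set j | x 0 j == 0]|.

Lemma hamming_dist_sub (F : finFieldType) n (x y : 'rV[F]_n) :
  hamming_dist x y = (n - num_zeros (x - y))%N.
Proof.
rewrite /hamming_dist /num_zeros -[X in (X - _)%N](card_ord n).
rewrite -[X in (X - _)%N](cardsC [set j | (x - y) 0 j == 0]) addKn.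
by apply: eq_card => j; rewrite !inE !mxE subr_eq0.
Qed.

(** The first [k - 1] columns of [M] form a matrix with more rows than columns, so its left kernel
    is nonzero. This supplies a codeword that attains the Singleton bound. *)
Lemma exists_codeword_vanishing (F : finFieldType) k n (M : 'M[F]_(k, n)) :
  (0 < k <= n)%N ->
  exists2 u : 'rV[F]_k, u != 0 &
    (k.-1 <= num_zeros (u *m M))%N.
Proof.
case/andP=> k_gt0 le_kn.
have le_k1n : (k.-1 <= n)%N by apply: leq_trans le_kn; apply: leq_pred.
pose N := colsub (widen_ord le_k1n) M.
have /rowV0Pn[u /sub_kermxP uN0 u_neq0] : kermx N != 0.
  rewrite kermx_eq0 /row_free neq_ltn; apply/orP; left.
  by apply: leq_ltn_trans (rank_leq_col N) _; rewrite prednK.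
exists u => //.
have inj_w : injective (widen_ord le_k1n).
  by move=> i j /(congr1 val) /= ij; apply: val_inj.
rewrite -[X in (X <= _)%N](card_ord k.-1) -(card_imset predT inj_w).
apply/subset_leq_card/subsetP => _ /imsetP[j _ ->]; rewrite inE.
move/matrixP/(_ 0 j): uN0; rewrite !mxE => /eqP; congr (_ == _).
by apply: eq_bigr => i _; rewrite !mxE.
Qed.

(** The zero codeword has [n >= k] zeros, so the bound on zeros makes [u *m M] injective in [u],
    whence dimension [k]. By linearity the same bound controls all distances, and
    [exists_codeword_vanishing] shows that it is attained. *)
Lemma generator_matrix_MDS (F : finFieldType) k n (M : 'M[F]_(k, n)) :
  (0 < k <= n)%N ->
  (forall u : 'rV[F]_k, u != 0 ->
     (num_zeros (u *m M) < k)%N) ->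
  is_MDS [set u *m M | u : 'rV[F]_k] k.
Proof.
move=> k_bounds few_zeros; have /andP[k_gt0 le_kn] := k_bounds.
have M_inj (u : 'rV[F]_k) : u *m M = 0 -> u = 0.
  move=> uM0; apply: contraTeq le_kn => /few_zeros; rewrite -ltnNge.
  rewrite /num_zeros uM0.
  suff ->: [set j | (0 : 'rV[F]_n) 0 j == 0] = setT by rewrite cardsT card_ord.
  by apply/setP=> j; rewrite !inE mxE eqxx.
have M_dist (u v : 'rV[F]_k) :
    hamming_dist (u *m M) (v *m M)
      = (n - num_zeros ((u - v) *m M))%N.
  by rewrite hamming_dist_sub mulmxBl.
split; last split.
- exists (limg (linfun (mulmxr M) : 'Hom('rV[F]_k, 'rV[F]_n))); split.
    move=> x; apply/imsetP/memv_imgP=> [[u _ ->]|[u _ ->]]; exists u;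
      by rewrite ?lfunE ?memvf.
  rewrite limg_dim_eq ?dimvf ?dim_matrix; first exact: mul1n.
  rewrite capfv; apply/eqP/lker0P => u v; rewrite !lfunE /= => /eqP.
  by rewrite -subr_eq0 -mulmxBl => /eqP /M_inj /eqP; rewrite subr_eq0 => /eqP.
- have [u u_neq0 u_zeros] := exists_codeword_vanishing M k_bounds.
  exists (u *m M), (0 *m M); split; try exact: imset_f.
    by apply: contra_neq u_neq0; rewrite mul0mx => /M_inj.
  rewrite M_dist subr0.
  have -> : num_zeros (u *m M) = k.-1.
    apply/eqP; rewrite eqn_leq u_zeros andbT -ltnS prednK //.
    exact: few_zeros.
  by rewrite -subn1 subnBA // addnBAC.
- move=> _ _ /imsetP[u _ ->] /imsetP[v _ ->] neq_uv; rewrite M_dist.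
  have /few_zeros : u - v != 0.
    by apply: contraNneq neq_uv => /eqP; rewrite subr_eq0 => /eqP ->.
  by move=> lt_k; rewrite addn1 -subSn // -[X in (_ <= X)%N]subSS leq_sub2l.
Qed.

Section TwistedPolynomials.

Variables (F : finFieldType) (k : nat) (eta : F).

Lemma coef_twisted_poly (f : k.-tuple F) i :
  (twisted_poly eta f)`_i = f`_i + (eta * f`_0) *+ (i == k).
Proof.
rewrite /twisted_poly coefD coefZ coefXn mulr_natr; congr (_ + _).
rewrite -(poly_def k (fun i => f`_i)) coef_poly.
by case: ltnP => // le_ki; rewrite nth_default ?size_tuple.
Qed.

Lemma size_twisted_poly (f : k.-tuple F) : (size (twisted_poly eta f) <= k.+1)%N.
Proof.
apply/leq_sizeP => i lt_ki; rewrite coef_twisted_poly nth_default.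
  by rewrite gtn_eqF // addr0.
by rewrite size_tuple ltnW.
Qed.

Lemma twisted_poly_roots (f : k.-tuple F) (s : seq F) :
    (0 < k)%N -> size s = k -> uniq s -> all (root (twisted_poly eta f)) s ->
  (forall i, f`_i = 0) \/ eta * \prod_(x <- s) - x = 1.
Proof.
move=> k_gt0 size_s uniq_s roots_s; set P := twisted_poly eta f in roots_s.
have P0 : P`_0 = f`_0 by rewrite coef_twisted_poly ltn_eqF // addr0.
have Pk : P`_k = eta * f`_0.
  by rewrite coef_twisted_poly eqxx nth_default ?size_tuple ?add0r.
have [Pk0|Pk_neq0] := eqVneq P`_k 0.
- left=> i.
  have size_P : (size P <= k)%N.
    apply/leq_sizeP => j; rewrite leq_eqVlt => /predU1P[<-//|lt_kj].
    by move/leq_sizeP: (size_twisted_poly f); apply.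
  have P_eq0 : P = 0.
    apply: contraTeq size_P => P_neq0; rewrite -ltnNge -size_s.
    exact: max_poly_roots.
  (* The twist [eta * f_0] is itself the coefficient [P_k], so once [P = 0] it disappears and each
     [f_i] is a coefficient of [P]. *)
  have := coef_twisted_poly f i; rewrite -/P -Pk !P_eq0 !coef0 mul0rn addr0.
  by move=> <-.
- right; have size_P : size P = k.+1.
    apply/eqP; rewrite eqn_leq size_twisted_poly ltnNge.
    by apply: contra Pk_neq0 => /leq_sizeP/(_ k (leqnn k)) ->.
  have P_prod : P = P`_k *: \prod_(z <- s) ('X - z%:P).
    rewrite {1}(all_roots_prod_XsubC _ roots_s) ?uniq_rootsE ?size_s //.
    by rewrite lead_coefE size_P.
  have f0_neq0 : f`_0 != 0 by apply: contraNneq Pk_neq0 => f0; rewrite Pk f0 mulr0.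
  (* Write [f_0] as [P(0)]; in the factored form each [X - x] contributes [- x], and the leading
     coefficient contributes a second [f_0] to cancel. *)
  apply: (mulIf f0_neq0); rewrite mul1r -{2}P0 -horner_coef0 P_prod.
  rewrite hornerZ horner_prod Pk mulrAC; congr (_ * _).
  by apply: eq_bigr => x _; rewrite !hornerE.
Qed.

(** The rows are the evaluations of the basis [1 + eta X^k, X, ..., X^(k-1)] of the space of twisted
    polynomials. *)
Definition TRS_generator n (alpha : n.-tuple F) : 'M[F]_(k, n) :=
  \matrix_(i, j) (tnth alpha j ^+ i
                  + (eta * tnth alpha j ^+ k) *+ (i == 0%N :> nat)).

Lemma mulmx_TRS_generator n (alpha : n.-tuple F) (u : 'rV[F]_k) j :
    (0 < k)%N ->
  (u *m TRS_generator alpha) 0 j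
    = (twisted_poly eta [tuple u 0 i | i < k]).[tnth alpha j].
Proof.
move=> k_gt0; pose i0 := Ordinal k_gt0.
have nth_u (i : 'I_k) : [tuple u 0 i | i < k]`_i = u 0 i.
  by rewrite -tnth_nth tnth_mktuple.
rewrite /twisted_poly !hornerE horner_sum (nth_u i0) mxE.
under eq_bigr => i _ do rewrite mxE mulrDr.
rewrite big_split /=; congr (_ + _).
  by apply: eq_bigr => i _; rewrite nth_u !hornerE.
rewrite (bigD1 i0) //= big1 ?addr0 => [|i i_neq0]; first by rewrite mulrCA mulrA.
by rewrite [X in _ *+ X](_ : _ = 0%N) ?mulr0 //; apply/eqP; rewrite eqb0.
Qed.

Lemma TRS_generatorE n (alpha : n.-tuple F) :
    (0 < k)%N ->
  TRS k alpha eta = [set u *m TRS_generator alpha | u : 'rV[F]_k].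
Proof.
move=> k_gt0; apply/setP=> x; apply/imsetP/imsetP => [[f _ ->]|[u _ ->]].
  exists (\row_i tnth f i) => //; apply/rowP => j.
  rewrite mulmx_TRS_generator // mxE; congr (twisted_poly _ _).[_].
  by apply: eq_from_tnth => i; rewrite tnth_mktuple mxE.
exists [tuple u 0 i | i < k] => //; apply/rowP => j.
by rewrite mulmx_TRS_generator // mxE.
Qed.

(** This reduces the MDS property, in any characteristic, to a condition on products of evaluation
    points: a nonzero codeword with [k] zeros would yield a forbidden product. *)
Lemma TRS_MDS n (alpha : n.-tuple F) :
    (0 < k <= n)%N -> uniq alpha ->
    (forall s : seq F, uniq s -> {subset s <= alpha} ->
       eta * \prod_(x <- s) - x != 1) ->
  is_MDS (TRS k alpha eta) k.
Proof.
move=> k_bounds uniq_alpha no_prod; have /andP[k_gt0 _] := k_bounds.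
rewrite TRS_generatorE //; apply: generator_matrix_MDS => // u u_neq0.
rewrite /num_zeros; set Z := [set j | _]; rewrite ltnNge; apply/negP => le_kZ.
(* Keep exactly [k] of the roots, as many as the largest possible degree, so that they determine the
   polynomial up to a scalar. *)
pose s := take k [seq tnth alpha j | j <- enum Z].
have uniq_s : uniq s.
  by apply/take_uniq; rewrite map_inj_uniq ?enum_uniq //; apply/tuple_uniqP.
have sub_s x : x \in s -> exists2 j, j \in Z & x = tnth alpha j.
  by move/mem_take/mapP=> [j]; rewrite mem_enum => jZ ->; exists j.
have size_s : size s = k by rewrite size_takel // size_map -cardE.
have roots_s : all (root (twisted_poly eta [tuple u 0 i | i < k])) s.
  apply/allP => _ /sub_s[j jZ ->]; rewrite /root -mulmx_TRS_generator //.
  by rewrite inE in jZ.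
case: (twisted_poly_roots k_gt0 size_s uniq_s roots_s) => [u0|prod1].
  case/eqP: u_neq0; apply/rowP => i; rewrite mxE -(u0 i).
  by rewrite -tnth_nth tnth_mktuple.
have sub_alpha : {subset s <= alpha} by move=> x /sub_s[j _ ->]; exact: mem_tnth.
by have := no_prod s uniq_s sub_alpha; rewrite prod1 eqxx.
Qed.

End TwistedPolynomials.

Local Open Scope group_scope.

(** Factors in [G] die in the quotient and every other factor contributes the same coset. The
    normaliser condition is there because [coset G] is multiplicative only on ['N(G)]. *)
Lemma coset_prod_count (gT : finGroupType) (G : {group gT}) (g : gT)
    (s : seq gT) :
    {subset s <= 'N(G)} ->
    (forall u, u \in s -> u \notin G -> coset G u = coset G g) ->
  coset G (\prod_(u <- s) u) = coset G g ^+ count [predC G] s.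
Proof.
elim: s => [|u s IHs] sN sg; first by rewrite big_nil morph1.
have uN : u \in 'N(G) by rewrite sN ?mem_head.
have s'N : {subset s <= 'N(G)} by move=> v vs; apply: sN; rewrite inE vs orbT.
have prodN : \prod_(v <- s) v \in 'N(G).
  by rewrite big_seq group_prod // => v /s'N.
rewrite big_cons morphM //= IHs //; last first.
  by move=> v vs; apply: sg; rewrite inE vs orbT.
have [uG|uG] := boolP (u \in G); first by rewrite coset_id // mul1g.
by rewrite sg ?mem_head // expgS.
Qed.

Local Open Scope ring_scope.


Theorem theorem3p3 (F : finFieldType) (m p : nat)
  (hF : #|F| = (2 ^ m)%N)
  (hcomp : composite (2 ^ m - 1))
  (hp : p = pdiv (2 ^ m - 1))
  (G : {group {unit F}})
  (hG : #|G| = ((2 ^ m - 1) %/ p)%N)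
  (gamma : {unit F})
  (hgamma : generator ([set: {unit F}] / G)%g (coset G gamma))
  (a : (p - 2).-tuple {unit F})
  (ha_uniq : uniq a)
  (ha : {subset a <= (gamma *: G)%g})
  (k n : nat) (hk : (1 <= k)%N) (hkn : (k < n)%N)
  (alpha : n.-tuple F)
  (halpha_uniq : uniq alpha)
  (halpha : {subset alpha <=
     0 |: [set FinRing.uval u | u in G :|: [set:: a]]})
  (eta : {unit F}) (heta : eta \in (gamma *: G)%g) :
  is_MDS (TRS k alpha (FinRing.uval eta)) k.

Proof.
(* The unit group of a finite field is cyclic, hence abelian, so [G] is normal in it. *)
have nGU : [set: {unit F}] \subset ('N(G))%g.
  have abU := cyclic_abelian (field_unit_group_cyclic [set: {unit F}]%G).
  by apply: normal_norm; rewrite -(sub_abelian_normal _ abU) subsetT.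
have nG (u : {unit F}) : u \in ('N(G))%g by rewrite (subsetP nGU) ?inE.
have cosetE (u : {unit F}) : u \in (gamma *: G)%g -> coset G u = coset G gamma.
  by rewrite -norm_rlcoset // => /(rcoset_kercosetP (nG u) (nG gamma)).
have /andP[N_gt1 _] := hcomp.
have p_prime : prime p by rewrite hp pdiv_prime.
(* The index of [G] is [N / (N / p)] with [N = 2^m - 1], which equals [p] because [p] divides
   [N]. *)
have order_gamma : #[coset G gamma]%g = p.
  rewrite orderE -(eqP hgamma) card_quotient // -divgS ?subsetT //.
  rewrite card_finField_unit hF -subn1 hG divnA ?mulKn ?(ltnW N_gt1) //.
  by rewrite hp pdiv_dvd.
have char2 : 2 \in [pchar F] by apply: card_finPcharP hF _.
apply: TRS_MDS halpha_uniq _; first by rewrite hk ltnW.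
move=> s uniq_s sub_s; apply/eqP => prod_s.
(* The point 0 may occur in [alpha], but as a factor it would make the product 0 instead of 1. Hence
   [s] lifts to a sequence of units. *)
have s_neq0 x : x \in s -> x != 0.
  move=> xs; apply: contra_eq_neq prod_s => x0.
  by rewrite (big_rem x) //= x0 oppr0 mul0r mulr0 eq_sym oner_eq0.
have [t s_t] : exists t : seq {unit F}, s = map val t.
  exists (pmap insub s); rewrite (pmap_filter (insubK _)).
  apply/esym/all_filterP/allP => x xs.
  by rewrite /= isSome_insub unitfE s_neq0.
have uniq_t : uniq t by rewrite s_t (map_inj_uniq val_inj) in uniq_s.
have t_Ga u : u \in t -> (u \in G) || (u \in a).
  move=> ut; have us : val u \in s by rewrite s_t map_f.
  have := halpha _ (sub_s _ us); rewrite !inE (negPf (s_neq0 _ us)) /=.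
  by case/imsetP=> v; rewrite !inE => ? /val_inj ->.
(* In characteristic 2 the signs vanish, so the field equation becomes one in the unit group. *)
have prod_t : (eta * \prod_(u <- t) u = 1)%g.
  apply: val_inj; rewrite -[RHS]prod_s /= s_t big_map; congr (_ * _).
  elim: {+}t => [|u r IHr]; first by rewrite !big_nil.
  by rewrite !big_cons /= IHr oppr_pchar2.
have count_t : (count [predC G] t <= p - 2)%N.
  rewrite -size_filter -(size_tuple a); apply: uniq_leq_size.
    exact: filter_uniq.
  move=> u; rewrite mem_filter /= => /andP[uG ut].
  by have := t_Ga u ut; rewrite (negPf uG).
have := congr1 (coset G) prod_t.
rewrite morph1 morphM //= (coset_prod_count (g := gamma)) //; last first.
  by move=> u /t_Ga/orP[-> //|/ha ua _]; apply: cosetE.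
(* With [c] the number of factors outside [G] and one more from [eta], [p] would divide [c + 1], yet
   [0 < c + 1 <= p - 1]. *)
rewrite cosetE // -expgS => /eqP; rewrite -order_dvdn order_gamma.
move/dvdn_leq => /(_ isT); rewrite leqNgt -ltnS => /negP; apply.
(* Since [p >= 2], the truncated difference [p - 2] is exact. *)
by rewrite -(subnK (prime_gt1 p_prime)) addn2 !ltnS.
Qed.
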